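(* Let $\mathbb{F}$ be a finite field and let $G$ be a finite group. Assume that $G$ has two abelian subgroups $A$ and $B$ such that every element of $G$ can be written as $ab$ with $a\in A$ and $b\in B$. Then every $G$-code over $\mathbb{F}$ is an abelian group code.
   Context: A linear code of length $n$ over $\mathbb{F}$ is a linear subspace of $\mathbb{F}^n$; $E=\{e_1,\dots,e_n\}$ is the standard basis of $\mathbb{F}^n$. For a group $G$ of order $n$, a linear code $C\subseteq\mathbb{F}^n$ is a $G$-code if there is a bijection $\phi:E\to G$ whose linear extension $\phi:\mathbb{F}^n\to\mathbb{F}G$ to the group algebra maps $C$ onto a two-sided ideal of $\mathbb{F}G$. An abelian group code is a linear code $C\subseteq \mathbb{F}^n$ which is an $A'$-code for some abelian group $A'$ of order $n$. *)

(* Defs.v *)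
From mathcomp Require Import all_boot all_order all_fingroup all_algebra.
From mathcomp Require Import all_character.

Set Implicit Arguments.
Unset Strict Implicit.
Unset Printing Implicit Defensive.

Import GRing.Theory.
Local Open Scope ring_scope.

(* Linear codes of length n are row spaces of matrices C : 'M[F]_(m, n), the  *)
(* encoding of subspaces of F^n used in mxalgebra. The group algebra FG is    *)
(* group_ring F G from mxrepresentation: the row space spanned by the         *)
(* matrices regular_repr F G x, for x \in G, each flattened by mxvec; these   *)
(* are linearly independent and multiply as the elements x do.                *)

(* The basis vector e_i is identified with its index i : 'I_n, so that a      *)
(* bijection E -> G is an injective phi : 'I_n -> gT with image G (hence      *)
(* n = #|G|). The i-th row of code_map_mx is the image of e_i in FG, so that  *)
(* v |-> v *m code_map_mx F G phi is the linear extension F^n -> FG of phi.   *)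
Definition code_map_mx (F : fieldType) (gT : finGroupType) (G : {group gT})
    (n : nat) (phi : 'I_n -> gT) : 'A[F]_(n, #|G|) :=
  \matrix_(i < n) mxvec (regular_repr F G (phi i)).

(* mx_ideal R S only states that S absorbs products with R on both sides; it  *)
(* does not require S to be contained in R.                                   *)
Definition two_sided_ideal (F : fieldType) (d m1 m2 : nat)
    (R : 'A[F]_(m1, d)) (S : 'A[F]_(m2, d)) : bool :=
  (S <= R)%MS && mx_ideal R S.

Definition is_group_code (F : fieldType) (m n : nat) (C : 'M[F]_(m, n))
    (gT : finGroupType) (G : {group gT}) : Prop :=
  exists phi : 'I_n -> gT,
    [/\ injective phi, [set phi i | i : 'I_n] = G
      & two_sided_ideal (group_ring F G) (C *m code_map_mx F G phi)].

Definition is_abelian_group_code (F : fieldType) (m n : nat)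
    (C : 'M[F]_(m, n)) : Prop :=
  exists (aT : finGroupType) (A : {group aT}), abelian A /\ is_group_code C A.

(* Main.v *)
(* Let x in A and y in B act on G by g |-> x g y. These permutations commute,
   since A and B are abelian, and move 1 to every element of G = AB. They
   therefore generate an abelian, transitive, hence regular group T of
   permutations, and they preserve every two-sided ideal of FG. Identifying
   t in T with the image of 1 under t turns such an ideal into an ideal
   of FT. *)
Require Import Defs.
From mathcomp Require Import all_boot all_order all_fingroup all_algebra.
From mathcomp Require Import all_character.

Set Implicit Arguments.
Unset Strict Implicit.
Unset Printing Implicit Defensive.

Import GroupScope GRing.Theory.
Local Open Scope ring_scope.

Lemma row_row_perm (R : Type) m n (s : 'S_m) (X : 'M[R]_(m, n)) i :
  row i (row_perm s X) = row (s i) X.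
Proof. by apply/rowP=> j; rewrite !mxE. Qed.

Section CodeMap.

Variables (F : fieldType) (gT : finGroupType) (G : {group gT}) (n : nat).
Variable phi : 'I_n -> gT.
Hypotheses (phi_inj : injective phi) (phi_im : [set phi i | i : 'I_n] = G).

Local Notation rG := (regular_repr F G).
Local Notation M := (code_map_mx F G phi).

Lemma code_map_mem i : phi i \in G.
Proof. by rewrite -phi_im imset_f. Qed.

Lemma code_map_onto g : g \in G -> exists i, phi i = g.
Proof. by rewrite -phi_im => /imsetP[i _ ->]; exists i. Qed.

Lemma row_code_map_mx i : row i M = mxvec (rG (phi i)).
Proof. exact: rowK. Qed.

Lemma code_map_mx_sub : (M <= group_ring F G)%MS.
Proof.
apply/row_subP=> i; rewrite row_code_map_mx.
exact/envelop_mx_id/code_map_mem.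
Qed.

(** The matrix has [n = #|G|] rows, and they include the basis of the group ring, whose rank is
    [#|G|]. *)
Lemma code_map_mx_free : row_free M.
Proof.
have dimG : #|G| = n by rewrite -phi_im card_imset // card_ord.
rewrite -row_leq_rank -{1}dimG.
apply: leq_trans (_ : \rank (group_ring F G) <= _)%N.
  by rewrite row_leq_rank gring_free.
apply: mxrankS.
apply/row_subP=> k; rewrite rowK.
have [i <-] := code_map_onto (enum_valP k).
by rewrite -row_code_map_mx row_sub.
Qed.

(** Row [i] of [perm_mx s] is the basis vector of index [s i], so permuting coordinates by [s]
    becomes left multiplication by [g] in FG. *)
Lemma perm_code_map_mxl g (s : 'S_n) : g \in G ->
  (forall i, phi (s i) = (g * phi i)%g) ->
  perm_mx s *m M = M *m lin_mulmx (rG g).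
Proof.
move=> Gg phi_s; apply/row_matrixP=> i.
rewrite -row_permE row_row_perm row_mul !row_code_map_mx mul_vec_lin /=.
by rewrite phi_s repr_mxM ?code_map_mem.
Qed.

Lemma perm_code_map_mxr g (s : 'S_n) : g \in G ->
  (forall i, phi (s i) = (phi i * g)%g) ->
  perm_mx s *m M = M *m lin_mulmxr (rG g).
Proof.
move=> Gg phi_s; apply/row_matrixP=> i.
rewrite -row_permE row_row_perm row_mul !row_code_map_mx mul_vec_lin /=.
by rewrite phi_s repr_mxM ?code_map_mem.
Qed.

Lemma code_map_perm (h : gT -> gT) :
    injective h -> (forall i, h (phi i) \in G) ->
  exists s : 'S_n, forall i, phi (s i) = h (phi i).
Proof.
move=> h_inj hG.
have ex_f i : exists j, phi j == h (phi i).
  by have [j <-] := code_map_onto (hG i); exists j.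
pose f i := xchoose (ex_f i).
have phi_f i : phi (f i) = h (phi i) := eqP (xchooseP (ex_f i)).
have f_inj : injective f.
  by move=> i j /(congr1 phi); rewrite !phi_f => /h_inj/phi_inj.
by exists (perm f_inj) => i; rewrite permE.
Qed.

Definition translation_perm g (s : 'S_n) :=
  [forall i, phi (s i) == (g * phi i)%g]
    || [forall i, phi (s i) == (phi i * g)%g].

(** FG is spanned by G, so absorbing products with FG amounts to absorbing translations by elements
    of G, and these permute the coordinates. *)
Lemma two_sided_ideal_code_mapP m (C : 'M[F]_(m, n)) :
  two_sided_ideal (group_ring F G) (C *m M) <->
  (forall g s, g \in G -> translation_perm g s -> (C *m perm_mx s <= C)%MS).
Proof.
split=> [/andP[_ /andP[/mulsmx_subP idl /mulsmx_subP idr]] g s Gg | stabC].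
  (* As the code map is injective, the inclusion can be tested on images in FG, row by row. *)
  case/orP=> /'forall_eqP phi_s; rewrite -(submxMfree _ _ code_map_mx_free);
    rewrite -mulmxA.
    rewrite (perm_code_map_mxl Gg phi_s) mulmxA.
    apply/row_subP=> k; rewrite row_mul -[row k _]vec_mxK mul_vec_lin /=.
    by apply: idl; rewrite ?envelop_mx_id // vec_mxK row_sub.
  rewrite (perm_code_map_mxr Gg phi_s) mulmxA.
  apply/row_subP=> k; rewrite row_mul -[row k _]vec_mxK mul_vec_lin /=.
  by apply: idr; rewrite ?envelop_mx_id // vec_mxK row_sub.
apply/andP; split.
  exact: submx_trans (submxMl _ _) code_map_mx_sub.
apply/andP; split; apply/mulsmx_subP=> X Y.
  (* By linearity, the factor from FG may be taken to be a single group element [g]. *)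
  case/envelop_mxP=> a -> CY; rewrite mulmx_suml linear_sum summx_sub // => g Gg.
  rewrite -scalemxAl linearZ scalemx_sub //.
  have [s phi_s] := code_map_perm (mulgI g) (fun i => groupM Gg (code_map_mem i)).
  rewrite -[X in (X <= _)%MS](mul_vec_lin (mulmx (rG g))).
  apply: submx_trans (submxMr _ CY) _.
  rewrite -mulmxA -(perm_code_map_mxl Gg phi_s) mulmxA submxMr //.
  by apply: (stabC g) => //; apply/orP; left; apply/'forall_eqP.
move=> CX /envelop_mxP[a ->]; rewrite mulmx_sumr linear_sum summx_sub // => g Gg.
rewrite -scalemxAr linearZ scalemx_sub //.
have [s phi_s] := code_map_perm (mulIg g) (fun i => groupM (code_map_mem i) Gg).
rewrite -[X in (X <= _)%MS](mul_vec_lin (mulmxr (rG g))).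
apply: submx_trans (submxMr _ CX) _.
rewrite -mulmxA -(perm_code_map_mxr Gg phi_s) mulmxA submxMr //.
by apply: (stabC g) => //; apply/orP; right; apply/'forall_eqP.
Qed.

End CodeMap.

(** The permutation automorphisms of [C]: inclusion already gives equality, since [perm_mx s] is
    invertible. *)
Definition code_aut (F : fieldType) m n (C : 'M[F]_(m, n)) :=
  [set s : 'S_n | (C *m perm_mx s <= C)%MS].

Lemma code_aut_group_set (F : fieldType) m n (C : 'M[F]_(m, n)) :
  group_set (code_aut C).
Proof.
apply/group_setP; split=> [|s t]; first by rewrite inE perm_mx1 mulmx1.
rewrite !inE => sC tC; rewrite perm_mxM mulmxA.
exact: submx_trans (submxMr _ sC) tC.
Qed.

Canonical code_aut_group (F : fieldType) m n (C : 'M[F]_(m, n)) :=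
  Group (code_aut_group_set C).

(** An abelian transitive group is regular, so each index [i] can be labelled by the unique element
    of [T] sending [i0] to [i]. *)
Lemma abelian_transitive_code (F : fieldType) m n (C : 'M[F]_(m, n))
    (T : {group 'S_n}) (i0 : 'I_n) :
    abelian T -> (forall i, exists2 t, t \in T & (t : 'S_n) i0 = i) ->
    T \subset code_aut C -> is_abelian_group_code C.
Proof.
move=> abT trT /subsetP autT.
have ex_phi i : exists t : 'S_n, (t \in T) && (t i0 == i).
  by have [t Tt <-] := trT i; exists t; rewrite Tt eqxx.
pose phi i := xchoose (ex_phi i).
have phiT i : phi i \in T by case/andP: (xchooseP (ex_phi i)).
have phiE i : phi i i0 = i by case/andP: (xchooseP (ex_phi i)) => _ /eqP.
have phi_inj : injective phi.
  by move=> i j /(congr1 (fun t : 'S_n => t i0)); rewrite !phiE.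
have commT (s t : 'S_n) i : s \in T -> t \in T -> s (t i) = t (s i).
  by move=> Ts Tt; rewrite -!permM (centsP abT s).
(* Both permutations commute with [phi i], which carries [i0] to [i]; agreement at [i0] thus spreads
   to every [i]. *)
have eqT (s t : 'S_n) : s \in T -> t \in T -> s i0 = t i0 -> s = t.
  move=> Ts Tt est; apply/permP=> i; rewrite -(phiE i).
  by rewrite !(commT _ (phi i)) // est.
have phi_im : [set phi i | i : 'I_n] = T.
  apply/setP=> t; apply/imsetP/idP=> [[i _ ->] // | Tt].
  by exists (t i0) => //; apply: eqT; rewrite ?phiE.
exists _, T; split=> //; exists phi; split=> //.
apply/(two_sided_ideal_code_mapP phi_inj phi_im) => t s Tt /orP ts.
(* Under this labelling, translation by [t] on either side is the permutation [t] itself. *)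
suff -> : s = t by move/autT: Tt; rewrite inE.
apply/permP=> i; rewrite -[LHS]phiE.
case: ts => /'forall_eqP->; rewrite permM ?phiE //.
by rewrite commT // phiE.
Qed.

Theorem theorem3p1 (F : finFieldType) (gT : finGroupType) (G A B : {group gT})
    (sAG : A \subset G) (sBG : B \subset G)
    (abelA : abelian A) (abelB : abelian B)
    (defG : forall g : gT, g \in G ->
       exists a b : gT, [/\ a \in A, b \in B & g = (a * b)%g])
    (m n : nat) (C : 'M[F]_(m, n)) (codeC : is_group_code C G) :
  is_abelian_group_code C.
Proof.
case: codeC => phi [phi_inj phi_im].
move/(two_sided_ideal_code_mapP phi_inj phi_im) => stabC.
pose L := [set s : 'S_n | [exists a in A, forall i, phi (s i) == (a * phi i)%g]].
pose R := [set s : 'S_n | [exists b in B, forall i, phi (s i) == (phi i * b)%g]].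
have LP (s : 'S_n) : reflect (exists2 a, a \in A & forall i, phi (s i) = (a * phi i)%g)
                    (s \in L).
  rewrite inE; by apply: (iffP exists_inP) => -[a Aa /'forall_eqP eq_s]; exists a => //;
    apply/'forall_eqP.
have RP (s : 'S_n) : reflect (exists2 b, b \in B & forall i, phi (s i) = (phi i * b)%g)
                    (s \in R).
  rewrite inE; by apply: (iffP exists_inP) => -[b Bb /'forall_eqP eq_s]; exists b => //;
    apply/'forall_eqP.
(* The base point is the index of the identity of [G]. *)
have [i0 phi0] := code_map_onto phi_im (group1 G).
apply: (@abelian_transitive_code _ _ _ _ <<L :|: R>>%G i0).
- have commI (s t : 'S_n) : (forall i, phi (t (s i)) = phi (s (t i))) -> commute s t.
    by move=> est; apply/permP=> i; rewrite !permM; apply: phi_inj.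
  (* A left and a right translation commute by associativity; two on the same side commute because
     [A] or [B] is abelian. *)
  rewrite abelian_gen; apply/centsP=> s /setUP[/LP|/RP] [x Xx sx] t;
    case/setUP=> [/LP|/RP] [y Xy ty]; apply: commI => i;
    rewrite !(sx, ty) ?mulgA //.
  + by rewrite (centsP abelA x).
  + by rewrite -!mulgA (centsP abelB x).
- move=> i; have [a [b [Aa Bb phi_i]]] := defG _ (code_map_mem phi_im i).
  have [s sa] := code_map_perm phi_inj phi_im (mulgI a)
    (fun j => groupM (subsetP sAG a Aa) (code_map_mem phi_im j)).
  have [t tb] := code_map_perm phi_inj phi_im (mulIg b)
    (fun j => groupM (code_map_mem phi_im j) (subsetP sBG b Bb)).
  (* Here [s] acts first and takes 1 to [a], then [t] takes [a] to [a * b]. *)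
  exists (s * t)%g.
    apply: groupM; apply: mem_gen; rewrite in_setU; apply/orP.
      by left; apply/LP; exists a.
    by right; apply/RP; exists b.
  by apply: phi_inj; rewrite permM tb sa phi0 mulg1 phi_i.
(* The generators are translations by elements of [G], so they preserve [C] by the ideal
   criterion. *)
- rewrite gen_subG; apply/subsetP=> s /setUP[/LP[a Aa sa] | /RP[b Bb sb]]; rewrite inE.
    apply: (stabC a); rewrite ?(subsetP sAG) //.
    by apply/orP; left; apply/'forall_eqP.
  apply: (stabC b); rewrite ?(subsetP sBG) //.
  by apply/orP; right; apply/'forall_eqP.
Qed.
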